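(* Let $O$ be an $A^+$ operator (respectively, a $J^+$ operator), and suppose that any arbitrary pair of tuples $t^\ell,t^m$ fed to $O$ can share a key, i.e. it cannot be excluded a priori for any pair of input tuples that $f_{MK}(t^\ell)\cap f_{MK}(t^m)\neq\emptyset$. Then $O$ might need data duplication for shared-nothing parallelism to correctly enforce $O$'s semantics. That is, there are input sequences of $O$ for which every correct shared-nothing execution that runs in parallel (input tuples are delivered to more than one instance of $O$) must deliver some input tuple to more than one instance of $O$.
   Context: Tuples and windows. A stream is an unbounded sequence of tuples. A tuple $t$ has a timestamp $t.\tau$ (event time, progressing in discrete increments $\delta$), possibly further metadata, and a payload $t.\varphi$. A stateful operator has a window advance $WA$ and a window size $WS$ with $WA<WS$; its windows cover the periods $[\ell WA,\ell WA+WS)$, $\ell\in\mathbb Z$. A window instance $w=\langle\zeta,l,k\rangle$ has internal state $\zeta$ (e.g. the tuples falling in it), left boundary $l$ (inclusive), right boundary $l+WS$ (exclusive) and key $k$. A tuple $t$ falls in $w$ if $l\le t.\tau<l+WS$ and $k$ is a key of $t$. The operator keeps distinct window instances for each key and for each of its $I$ input streams. No assumption is made on the frequency, periodicity or timing of tuples, so the timestamp of the next input tuple cannot be inferred from that of previous ones. Operators. An Aggregate $A$ has $I=1$ input stream and functions $f_A$ (aggregates the tuples falling in one window instance $w$ into the payload of the output tuple created for $w$) and $f_R$ (incrementally updates $w.\zeta$). A Join $J$ has $I=2$ input streams $L$ and $R$ and a function $f_J$ that matches pairs of tuples, one from each stream, falling in window instances that share the same boundaries and the same key; each matched pair yields at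 most one output tuple. In $A$ and $J$ a single key-by function $f_{SK}$ extracts exactly one key from each tuple. $A^+$ and $J^+$ are the generalizations of $A$ and $J$ in which $f_{SK}$ is replaced by a multi key-by function $f_{MK}$, which maps a tuple to a (possibly empty) set of keys; a tuple then contributes to window instances of every key in $f_{MK}(t)$. Shared-nothing (SN) parallelism. The operator is run as several instances. Each instance has its own dedicated input/output queues and its own dedicated state, not accessed by other instances. Each input tuple is routed upstream to instances via their queues. Data duplication means that (copies of) one input tuple are delivered to more than one instance. Correctness. The execution of the instances of an operator is correct if any subset of input tuples that, according to the operator's specification, could jointly contribute to an output tuple is indeed processed together and results in that output tuple (if any). For $A^+$: all input tuples falling in one window instance (same period, same key) are jointly processed by $f_A$ and/or used by $f_R$ to update the same state. For $J^+$: every pair $\langle t_L,t_R\rangle$ with $t_L\in w_L$, $t_R\in w_R$, $w_L.l=w_R.l$ and sharing the key of $w_L,w_R$ is processed by $f_J$. *)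

(* Defs.v *)
From Stdlib Require List.
From HB Require Import structures.
From mathcomp Require Import all_boot all_order all_algebra.
Set Implicit Arguments.
Unset Strict Implicit.
Unset Printing Implicit Defensive.
Import Order.TTheory GRing.Theory Num.Theory.
Local Open Scope ring_scope.

(* Time is the event-time domain (it may be
   instantiated by int, rat or the reals), Meta the type of the metadata and
   Key the type of the keys. Sets of keys are boolean predicates, not assumed
   finite. *)

Record stuple (Time : archiRealDomainType) (Meta Phi : Type) := STuple {
  ts : Time;
  meta : Meta;
  payload : Phi
}.

(* zeta is the state, lb the (inclusive) left boundary, wkey the key. *)
Record winst (Time : archiRealDomainType) (Key State : Type) := WInst {
  zeta : State;
  lb : Time;
  wkey : Key
}.

(* The part common to A+ and J+. Streams is the type of names of the input
   streams; each stream has its own payload type, and one multi key-by function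
   applies to the tuples of all of them. *)
Record windowed_op (Time : archiRealDomainType) (Meta Key Streams : Type) :=
  WindowedOp {
    Phi : Streams -> Type;
    WA : Time;
    WS : Time;
    WA_gt0 : 0 < WA;
    WA_lt_WS : WA < WS;
    f_MK : forall x : Streams, stuple Time Meta (Phi x) -> pred Key
  }.

Section Input.
Context {Time : archiRealDomainType} {Meta Key Streams : Type}.
Variable O : windowed_op Time Meta Key Streams.

Definition item := {x : Streams & stuple Time Meta (Phi O x)}.

Definition item_ts (t : item) : Time := ts (projT2 t).

Definition item_keys (t : item) : pred Key := @f_MK _ _ _ _ O _ (projT2 t).

(* t falls in the window instances with period [l WA, l WA + WS) and key k. *)
Definition falls_in (t : item) (l : int) (k : Key) : bool :=
  (WA O *~ l <= item_ts t < WA O *~ l + WS O) && item_keys t k.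

Definition on_grid (delta tau : Time) : Prop := exists z : int, tau = delta *~ z.

(* An input sequence lists, in arrival order, finitely many tuples from all the
   input streams. Timestamps are multiples of delta; nothing else is imposed on
   them. *)
Definition is_input (delta : Time) (s : seq item) : Prop :=
  forall n : 'I_(size s), on_grid delta (item_ts (tnth (in_tuple s) n)).

(* "A priori" means before the content (metadata and payload) of the tuples is
   known: whatever streams two tuples come from and whatever their timestamps
   are, some contents make them share a key. This does not say that every two
   tuples do share a key. *)
Definition any_pair_can_share_key (delta : Time) : Prop :=
  forall (x y : Streams) (tau tau' : Time),
    on_grid delta tau -> on_grid delta tau' ->
    exists (t : stuple Time Meta (Phi O x)) (t' : stuple Time Meta (Phi O y)),
      [/\ ts t = tau, ts t' = tau' & exists k, f_MK t k && f_MK t' k].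

(* Shared-nothing executions over the input sequence s. Tuples are identified by
   their position in s, so that equal tuples at different positions remain
   distinct. [delivered n] is the set of instances whose queues receive (a copy
   of) the n-th tuple. [maintains i l k] tells whether instance i keeps window
   instances for period l and key k: this covers both instances that serve all
   keys and instances that ignore the keys assigned to other instances. *)
Record sn_execution (s : seq item) := SNExecution {
  ninst : nat;
  delivered : 'I_(size s) -> {set 'I_ninst};
  maintains : 'I_ninst -> int -> Key -> bool
}.

Definition runs_in_parallel (s : seq item) (E : sn_execution s) : Prop :=
  (1 < #|\bigcup_(n : 'I_(size s)) delivered E n|)%N.

Definition duplicates_data (s : seq item) (E : sn_execution s) : Prop :=
  exists n : 'I_(size s), (1 < #|delivered E n|)%N.

Definition falling (s : seq item) (l : int) (k : Key) : seq 'I_(size s) :=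
  [seq n <- enum 'I_(size s) | falls_in (tnth (in_tuple s) n) l k].

(* Only tuples delivered to i reach i's window instances: neither queues nor
   state are shared. *)
Definition held (s : seq item) (E : sn_execution s) (i : 'I_(ninst E))
    (l : int) (k : Key) : seq 'I_(size s) :=
  [seq n <- falling s l k | maintains i l k && (i \in delivered E n)].

End Input.

(* f_R returns the updated state of a window instance. Aggregates that collect
   the tuples and call f_A once on all of them are the case State = seq of
   tuples, with f_R appending the new tuple. *)
Record aggregate_plus (Time : archiRealDomainType) (Meta Key : Type) :=
  AggregatePlus {
    A_op :> windowed_op Time Meta Key unit;
    A_State : Type;
    A_PhiOut : Type;
    A_init : A_State;
    f_R : winst Time Key A_State -> stuple Time Meta (Phi A_op tt) -> A_State;
    f_A : winst Time Key A_State -> A_PhiOut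
  }.

Section Aggregate.
Context {Time : archiRealDomainType} {Meta Key : Type}.
Variable O : aggregate_plus Time Meta Key.

Definition A_tuple (t : item O) : stuple Time Meta (Phi O tt) :=
  match t with existT tt u => u end.

(* Window instance obtained from the tuples at positions ps, in that order. *)
Definition A_window (s : seq (item O)) (l : int) (k : Key)
    (ps : seq 'I_(size s)) : winst Time Key (A_State O) :=
  foldl (fun w n => WInst (f_R w (A_tuple (tnth (in_tuple s) n))) (lb w) (wkey w))
        (WInst (A_init O) (WA O *~ l) k) ps.

(* A window instance exists only if some tuple falls in it. *)
Definition A_output (s : seq (item O)) (l : int) (k : Key)
    (ps : seq 'I_(size s)) : option (A_PhiOut O) :=
  if ps is [::] then None else Some (f_A (A_window l k ps)).

Definition A_correct (s : seq (item O)) (E : sn_execution s) : Prop :=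
  forall (l : int) (k : Key), falling s l k != [::] ->
    exists i : 'I_(ninst E),
      {subset falling s l k <= held i l k} /\
      A_output l k (held i l k) = A_output l k (falling s l k).

End Aggregate.

Inductive side := sideL | sideR.

Record join_plus (Time : archiRealDomainType) (Meta Key : Type) :=
  JoinPlus {
    J_op :> windowed_op Time Meta Key side;
    J_PhiOut : Type;
    f_J : stuple Time Meta (Phi J_op sideL) ->
          stuple Time Meta (Phi J_op sideR) -> option J_PhiOut
  }.

Section Join.
Context {Time : archiRealDomainType} {Meta Key : Type}.
Variable O : join_plus Time Meta Key.

Definition left_tuple (t : item O) : option (stuple Time Meta (Phi O sideL)) :=
  match t with existT sideL u => Some u | existT sideR _ => None end.

Definition right_tuple (t : item O) : option (stuple Time Meta (Phi O sideR)) :=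
  match t with existT sideL _ => None | existT sideR u => Some u end.

(* The window instances of the two streams, for the same boundaries and key. *)
Definition J_windowL (s : seq (item O)) (l : int) (k : Key) (ps : seq 'I_(size s)) :=
  WInst (pmap (fun n => left_tuple (tnth (in_tuple s) n)) ps) (WA O *~ l) k.

Definition J_windowR (s : seq (item O)) (l : int) (k : Key) (ps : seq 'I_(size s)) :=
  WInst (pmap (fun n => right_tuple (tnth (in_tuple s) n)) ps) (WA O *~ l) k.

Definition J_outputs (s : seq (item O)) (l : int) (k : Key)
    (ps : seq 'I_(size s)) : seq (J_PhiOut O) :=
  pmap id [seq f_J tL tR | tL <- zeta (J_windowL l k ps), tR <- zeta (J_windowR l k ps)].

(* List.In is used because the type of output payloads need not be an eqType. *)
Definition J_correct (s : seq (item O)) (E : sn_execution s) : Prop :=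
  forall (l : int) (k : Key) (n m : 'I_(size s)) tL tR,
    n \in falling s l k -> m \in falling s l k ->
    left_tuple (tnth (in_tuple s) n) = Some tL ->
    right_tuple (tnth (in_tuple s) m) = Some tR ->
    exists i : 'I_(ninst E),
      [/\ n \in held i l k, m \in held i l k
        & forall o, f_J tL tR = Some o -> List.In o (J_outputs l k (held i l k))].

End Join.

(* Main.v *)
(* Feed the operator two tuples with timestamp 0 that share a key k. Both fall
   in the window [0, WS) for k, so correctness forces a single instance to
   receive both of them; a second active instance must then receive a copy of
   one of the two. Broadcasting to two instances shows that correct parallel
   executions of this input exist. *)

Require Import Defs.
From Stdlib Require List.
From HB Require Import structures.
From mathcomp Require Import all_boot all_order all_algebra.
Set Implicit Arguments.
Unset Strict Implicit.
Unset Printing Implicit Defensive.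
Import Order.TTheory GRing.Theory Num.Theory.
Local Open Scope ring_scope.

Section Executions.
Context {Time : archiRealDomainType} {Meta Key Streams : Type}.
Variable O : windowed_op Time Meta Key Streams.

Lemma is_input_ts0 (delta : Time) (s : seq (item O)) :
  (forall n, item_ts (tnth (in_tuple s) n) = 0) -> is_input delta s.
Proof. by move=> ts0 n; exists 0; rewrite ts0 mulr0z. Qed.

(** The period of index 0 starts at [WA O *~ 0 = 0], so the lower bound is an equality and the upper
    one reduces to [0 < WS O]. *)
Lemma falls_in_ts0 (t : item O) (k : Key) :
  item_ts t = 0 -> item_keys t k -> falls_in t 0 k.
Proof.
move=> t0 tk; rewrite /falls_in t0 tk mulr0z lexx add0r andbT /=.
exact: lt_trans (WA_gt0 O) (WA_lt_WS O).
Qed.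

Lemma mem_falling (s : seq (item O)) l k (n : 'I_(size s)) :
  (n \in falling s l k) = falls_in (tnth (in_tuple s) n) l k.
Proof. by rewrite mem_filter mem_enum andbT. Qed.

Lemma held_delivered (s : seq (item O)) (E : sn_execution s) i l k n :
  n \in held (E := E) i l k -> i \in delivered E n.
Proof. by rewrite mem_filter => /andP[/andP[]]. Qed.

(** Without duplication each delivery set, which contains [i], would be exactly [[set i]]; the union
    of these sets would then have at most one element, against parallelism. *)
Lemma parallel_common_instance_duplicates (s : seq (item O))
    (E : sn_execution s) (i : 'I_(ninst E)) :
  (forall n, i \in delivered E n) -> runs_in_parallel E -> duplicates_data E.
Proof.
move=> iE parE.
case: (pickP (fun n => (1 < #|delivered E n|)%N)) => [n dup | nodup].
  by exists n.
suff sub : \bigcup_(n : 'I_(size s)) delivered E n \subset [set i].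
  by move: (leq_trans parE (subset_leq_card sub)); rewrite cards1.
apply/bigcupsP => n _; apply/subsetP => j jn; rewrite inE.
have /card_le1_eqP le1 : (#|delivered E n| <= 1)%N by rewrite leqNgt nodup.
by apply/eqP/le1.
Qed.

(** Witness that correct parallel executions exist: each of the two instances sees the whole input
    and maintains every window. *)
Definition broadcast (s : seq (item O)) : sn_execution s :=
  SNExecution (ninst := 2) (fun _ => setT) (fun _ _ _ => true).

Lemma held_broadcast (s : seq (item O)) (i : 'I_2) l k :
  held (E := broadcast s) i l k = falling s l k.
Proof. by apply/all_filterP/allP => n _ /=; rewrite inE. Qed.

Lemma broadcast_parallel (s : seq (item O)) :
  (0 < size s)%N -> runs_in_parallel (broadcast s).
Proof.
move=> s_gt0; apply: leq_trans (subset_leq_card _).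
  by rewrite -[X in (X <= _)%N](card_ord 2) -cardsT.
(* The delivery set of the first tuple is already all of ['I_2]. *)
exact: (bigcup_sup (Ordinal s_gt0)).
Qed.

End Executions.

(** Passes from [\in] on positions, which form an [eqType], to [List.In] on payload-carrying tuples,
    which need not. *)
Lemma In_pmap (T : eqType) (U : Type) (f : T -> option U) (s : seq T) x u :
  x \in s -> f x = Some u -> List.In u (pmap f s).
Proof.
elim: s => //= y s IHs; rewrite inE => /orP[/eqP<- -> | xs fx]; first by left.
by case: (f y) => [v|] /=; [right|]; apply: IHs.
Qed.

(** Induction on [s] finds the row of [x], then induction on [t] finds [y] in it; [pmap id] discards
    only the [None] entries. *)
Lemma In_pmap_allpairs (S T U : Type) (f : S -> T -> option U) s t x y u :
  List.In x s -> List.In y t -> f x y = Some u ->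
  List.In u (pmap id [seq f a b | a <- s, b <- t]).
Proof.
move=> xs yt fxy; elim: s xs => //= a s IHs [-> | xs].
  rewrite pmap_cat; apply/List.in_or_app; left.
  elim: t yt {IHs} => //= b t IHt [-> | yt]; first by rewrite fxy; left.
  by case: (f x b) => [v|] /=; [right|]; apply: IHt.
by rewrite pmap_cat; apply/List.in_or_app; right; apply: IHs.
Qed.

Lemma broadcast_A_correct (Time : archiRealDomainType) (Meta Key : Type)
    (O : aggregate_plus Time Meta Key) (s : seq (item O)) :
  A_correct (broadcast s).
Proof.
move=> l k _; exists (ord0 : 'I_2); rewrite held_broadcast.
by split=> [n|].
Qed.

Lemma broadcast_J_correct (Time : archiRealDomainType) (Meta Key : Type)
    (O : join_plus Time Meta Key) (s : seq (item O)) :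
  J_correct (broadcast s).
Proof.
move=> l k n m tL tR nF mF nL mR; exists (ord0 : 'I_2); rewrite held_broadcast.
split=> // o; apply: In_pmap_allpairs; [exact: In_pmap nF nL | exact: In_pmap mF mR].
Qed.

Theorem theorem1 (Time : archiRealDomainType) (Meta Key : Type)
    (delta : Time) (delta_gt0 : 0 < delta) :
  (forall O : aggregate_plus Time Meta Key,
     any_pair_can_share_key O delta ->
     exists s : seq (item O),
       [/\ is_input delta s,
           (1 < size s)%N,
           exists E : sn_execution s, A_correct E /\ runs_in_parallel E
         & forall E : sn_execution s,
             A_correct E -> runs_in_parallel E -> duplicates_data E])
  /\
  (forall O : join_plus Time Meta Key,
     any_pair_can_share_key O delta ->
     exists s : seq (item O),
       [/\ is_input delta s,
           (1 < size s)%N,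
           exists E : sn_execution s, J_correct E /\ runs_in_parallel E
         & forall E : sn_execution s,
             J_correct E -> runs_in_parallel E -> duplicates_data E]).
Proof.
split=> O share.
- have grid0 : on_grid delta 0 by exists 0; rewrite mulr0z.
  have [t [t' [t0 t'0 [k /andP[tk t'k]]]]] := share tt tt 0 0 grid0 grid0.
  pose s : seq (item O) := [:: existT _ tt t; existT _ tt t'].
  have fall n : n \in falling s 0 k.
    (* The default of [nth] is never reached, as [n] is 0 or 1. *)
    rewrite mem_falling (tnth_nth (existT _ tt t)).
    by case: n => [[|[|//]] ?]; apply: falls_in_ts0.
  exists s; split=> //.
  + apply: is_input_ts0 => n; rewrite (tnth_nth (existT _ tt t)).
    by case: n => [[|[|//]] ?].
  + by exists (broadcast s); split; [apply: broadcast_A_correct | apply: broadcast_parallel].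
  + move=> E corrE.
    (* A single instance [i] must hold every position falling in the window, here the whole
       input. *)
    have [|i [sub _]] := corrE 0 k.
      by apply/eqP => F0; have := fall ord0; rewrite F0.
    apply: (@parallel_common_instance_duplicates _ _ _ _ _ _ _ i) => n.
    exact/held_delivered/sub/fall.
- have grid0 : on_grid delta 0 by exists 0; rewrite mulr0z.
  (* One tuple per side, since correctness of a join only constrains pairs from opposite streams. *)
  have [t [t' [t0 t'0 [k /andP[tk t'k]]]]] := share sideL sideR 0 0 grid0 grid0.
  pose s : seq (item O) := [:: existT _ sideL t; existT _ sideR t'].
  have fall n : n \in falling s 0 k.
    rewrite mem_falling (tnth_nth (existT _ sideL t)).
    by case: n => [[|[|//]] ?]; apply: falls_in_ts0.
  exists s; split=> //.
  + apply: is_input_ts0 => n; rewrite (tnth_nth (existT _ sideL t)).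
    by case: n => [[|[|//]] ?].
  + by exists (broadcast s); split; [apply: broadcast_J_correct | apply: broadcast_parallel].
  + move=> E corrE.
    (* [ord0] and [ord_max] are the positions of [t] and [t']; being the only two, they make [i]
       common to all deliveries. *)
    have [||i [iL iR _]] := corrE 0 k ord0 ord_max t t' (fall _) (fall _).
    * by rewrite (tnth_nth (existT _ sideL t)).
    * by rewrite (tnth_nth (existT _ sideL t)).
    apply: (@parallel_common_instance_duplicates _ _ _ _ _ _ _ i) => n.
    have [->|->] : n = ord0 \/ n = ord_max.
      by case: n => [[|[|//]] ?]; [left | right]; apply: val_inj.
    * exact: held_delivered iL.
    * exact: held_delivered iR.
Qed.
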